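(* For all $J_0, J_1 \in \mathcal{TBT}$, we have $$\mathbf{E}_{J_0}\cdot\mathbf{E}_{J_1} = \mathbf{E}_{J_0 / J_1} \qquad\text{and}\qquad \mathbf{H}_{J_0}\cdot\mathbf{H}_{J_1} = \mathbf{H}_{J_0 \backslash J_1}.$$
   Context: The ground field $\mathbb{K}$ has characteristic zero. $\mathfrak{S} = \bigcup_{n\ge 0}\mathfrak{S}_n$ is the set of all permutations, seen as words. The shifted shuffle $\sigma \mathbin{\overline{\sqcup\!\sqcup}} \nu$ of permutations $\sigma,\nu$ is the set (formal sum) of all shuffles of the word $\sigma$ with the word obtained from $\nu$ by adding $|\sigma|$ to each letter. $\mathbf{FQSym}$ is the Hopf algebra with basis $\{\mathbf{F}_\sigma\}_{\sigma\in\mathfrak{S}}$ and product $\mathbf{F}_\sigma\cdot\mathbf{F}_\nu = \sum_{\pi\in\sigma\,\overline{\sqcup\!\sqcup}\,\nu}\mathbf{F}_\pi$ (its coproduct is deconcatenation followed by standardization of both factors). The permutohedron order $\leq_{\mathrm{P}}$ on $\mathfrak{S}_n$ is the partial order in which $\sigma$ is covered by $\nu$ if $\sigma = u\,a\,b\,v$ and $\nu = u\,b\,a\,v$ with letters $a < b$. Binary trees are planar; each internal node (called node) has a left and a right child, possibly a leaf; $\perp$ is the empty tree. The canopy $\mathrm{cnp}(T)$ of a binary tree $T$ is the word on $\{0,1\}$ obtained by reading the leaves of $T$ from left to right, omitting the first and the last one, writing $0$ if the leaf is oriented to the right (is the right child of its parent) and $1$ otherwise. A pair of twin binary trees is a pair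 $(T_L,T_R)$ of binary trees with the same number $n$ of nodes such that $\mathrm{cnp}(T_L)_i \neq \mathrm{cnp}(T_R)_i$ for all $1 \leq i \leq n-1$. $\mathcal{TBT}_n$ is the set of these pairs, and $\mathcal{TBT}=\bigcup_{n\ge0}\mathcal{TBT}_n$. For a permutation $\sigma$, $\mathbb{P}(\sigma) = (T_L, T_R) \in \mathcal{TBT}$ is the pair of unlabeled trees obtained as follows. Start with $(\perp,\perp)$ and insert the letters of $\sigma$ from left to right, inserting each letter $a$ by a leaf insertion in $T_L$ and a root insertion in $T_R$; at the end forget the labels. Leaf insertion of $a$ in a labeled tree: if the tree is empty the result is the one-node tree labeled $a$; otherwise, if $a$ is smaller than the root's label, leaf-insert $a$ in the left subtree, else in the right subtree. Root insertion of $a$ in a binary search tree $T$: the result has a root labeled $a$, left subtree $T_{\leq a}$ and right subtree $T_{>a}$, where $T_{\leq a}$ (resp. $T_{>a}$) is the binary search tree on exactly the nodes of $T$ with label $\leq a$ (resp. $>a$) such that if $x$ is an ancestor of $y$ in it, then $x$ is an ancestor of $y$ in $T$. The partial order $\leq_{\mathrm{B}}$ on $\mathcal{TBT}_n$ is defined by: $J_0 \leq_{\mathrm{B}} J_1$ if there exist $\sigma_0,\sigma_1\in\mathfrak{S}_n$ with $\mathbb{P}(\sigma_0)=J_0$, $\mathbb{P}(\sigma_1)=J_1$, $\sigma_0\leq_{\mathrm{P}}\sigma_1$. $\mathbf{Baxter}$ is the Hopf subalgebra of $\mathbf{FQSym}$ with basis $\mathbf{P}_J = \sum_{\sigma\in\mathfrak{S},\,\mathbb{P}(\sigma)=J}\mathbf{F}_\sigma$,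 $J\in\mathcal{TBT}$. The elementary and homogeneous families are $\mathbf{E}_J := \sum_{J \leq_{\mathrm{B}} J'}\mathbf{P}_{J'}$ and $\mathbf{H}_J := \sum_{J' \leq_{\mathrm{B}} J}\mathbf{P}_{J'}$. For binary trees $T_0,T_1$: $T_0 / T_1$ is obtained by grafting the root of $T_0$ on the leftmost leaf of $T_1$; $T_0\backslash T_1$ is obtained by grafting the root of $T_1$ on the rightmost leaf of $T_0$. For $J_0=(T^0_L,T^0_R)$ and $J_1=(T^1_L,T^1_R)$ in $\mathcal{TBT}$: $J_0 / J_1 := (T^0_L\backslash T^1_L,\ T^0_R / T^1_R)$ and $J_0\backslash J_1 := (T^0_L / T^1_L,\ T^0_R\backslash T^1_R)$, which are pairs of twin binary trees. *)

(* Defs.v *)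
From Stdlib Require Import Relation_Operators.
From HB Require Import structures.
From mathcomp Require Import all_boot all_order all_algebra.
From mathcomp Require Import finmap.
From mathcomp Require Import boolp.
From mathcomp Require Import monalg.

Set Implicit Arguments.
Unset Strict Implicit.
Unset Printing Implicit Defensive.

Import GRing.Theory.
Local Open Scope ring_scope.

Definition is_permut (w : seq nat) : bool := perm_eq w (iota 1 (size w)).

(* A permutation is identified with its word on the letters 1, ..., n. *)
Record permut := Permut { word :> seq nat; wordP : is_permut word }.

HB.instance Definition _ := [isSub for word].
HB.instance Definition _ := [Countable of permut by <:].

Definition permuts (n : nat) : seq permut := pmap insub (permutations (iota 1 n)).

Lemma mem_permuts n (s : permut) : (s \in permuts n) = (size s == n).
Proof.
rewrite /permuts mem_pmap_sub mem_permutations; apply/idP/eqP => [/perm_size|<-].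
  by rewrite size_iota.
exact: wordP.
Qed.

Lemma uniq_permuts n : uniq (permuts n).
Proof. exact/pmap_sub_uniq/permutations_uniq. Qed.

(* Shuffles are listed with multiplicity; in [shifted_shuffle_word] the letters
   of the two factors are disjoint, so that there is no repetition. *)
Fixpoint shuffle (T : Type) (u : seq T) : seq T -> seq (seq T) :=
  if u is a :: u' then
    fix shuffle_u v := if v is b :: v' then
        [seq a :: w | w <- shuffle u' v] ++ [seq b :: w | w <- shuffle_u v']
      else [:: u]
  else fun v => [:: v].

Definition shifted_shuffle_word (u v : seq nat) : seq (seq nat) :=
  shuffle u [seq (x + size u)%N | x <- v].

Definition shifted_shuffle (s t : permut) : seq permut :=
  pmap insub (shifted_shuffle_word s t).

Lemma shuffle_perm (T : eqType) (u v w : seq T) :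
  w \in shuffle u v -> perm_eq w (u ++ v).
Proof.
elim: u v w => [|a u IHu] v w /=; first by rewrite inE => /eqP->.
elim: v w => [|b v IHv] w /=; first by rewrite inE cats0 => /eqP->.
rewrite mem_cat => /orP[] /mapP[w' w'P ->].
  by rewrite perm_cons; apply: IHu.
rewrite perm_sym -cat_cons perm_catC cat_cons perm_cons perm_catC perm_sym.
exact: IHv.
Qed.

(* No shuffle is lost by [pmap insub] in [shifted_shuffle]. *)
Lemma map_shifted_shuffle (s t : permut) :
  map word (shifted_shuffle s t) = shifted_shuffle_word s t.
Proof.
rewrite /shifted_shuffle -[map _ _]/(map val _) (pmap_filter (insubK _)).
apply/all_filterP/allP => w /shuffle_perm wP; rewrite /= isSome_insub.
rewrite /is_permut (perm_size wP) size_cat size_map iotaD.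
apply: (perm_trans wP); apply: perm_cat; first exact: wordP.
have -> : iota (1 + size s) (size t) = [seq (x + size s)%N | x <- iota 1 (size t)].
  by rewrite addnC iotaDl; apply: eq_map => x; rewrite addnC.
exact/perm_map/wordP.
Qed.

Definition permutohedron_cover (s t : permut) : Prop :=
  exists (u v : seq nat) (a b : nat),
    [/\ (a < b)%N, word s = u ++ [:: a, b & v] & word t = u ++ [:: b, a & v]].

(* s <= t also forces s and t to have the same size. *)
Definition perm_le : permut -> permut -> Prop :=
  clos_refl_trans permut permutohedron_cover.

Inductive tree := Leaf | Node of tree & tree.

Fixpoint tree_encode (T : tree) : GenTree.tree unit :=
  if T is Node l r then GenTree.Node 0 [:: tree_encode l; tree_encode r]
  else GenTree.Leaf tt.

Fixpoint tree_decode (t : GenTree.tree unit) : option tree :=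
  match t with
  | GenTree.Leaf _ => Some Leaf
  | GenTree.Node _ [:: l; r] =>
      if (tree_decode l, tree_decode r) is (Some l', Some r')
      then Some (Node l' r') else None
  | _ => None
  end.

Lemma tree_encodeK : pcancel tree_encode tree_decode.
Proof. by elim=> [|l IHl r IHr] //=; rewrite IHl IHr. Qed.

HB.instance Definition _ := Countable.copy tree (pcan_type tree_encodeK).

Fixpoint nodes (T : tree) : nat :=
  if T is Node l r then (nodes l + nodes r).+1 else 0.

(* Orientations of the leaves from left to right: [true] (the letter 1) for a
   left child and [false] (the letter 0) for a right child; [d] is the
   orientation of T itself in its parent. *)
Fixpoint leaves (d : bool) (T : tree) : seq bool :=
  if T is Node l r then leaves true l ++ leaves false r else [:: d].

Lemma size_leaves d T : size (leaves d T) = (nodes T).+1.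
Proof.
by elim: T d => //= l IHl r IHr _; rewrite size_cat IHl IHr addSn addnS.
Qed.

(* T has one more leaf than nodes: [take] omits the last one, [behead] the
   first one. The value given to [d] is irrelevant. *)
Definition canopy (T : tree) : seq bool :=
  behead (take (nodes T) (leaves false T)).

(* [graft_over] is T0 / T1 and [graft_under] is T0 \ T1. *)
Fixpoint graft_over (T0 T1 : tree) : tree :=
  if T1 is Node l r then Node (graft_over T0 l) r else T0.

Fixpoint graft_under (T0 T1 : tree) : tree :=
  if T0 is Node l r then Node l (graft_under r T1) else T1.

Fixpoint height (T : tree) : nat :=
  if T is Node l r then (maxn (height l) (height r)).+1 else 0.

Fixpoint trees_upto (h : nat) : seq tree :=
  Leaf :: (if h is h'.+1
           then [seq Node l r | l <- trees_upto h', r <- trees_upto h'] else [::]).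

Definition trees (n : nat) : seq tree := [seq T <- trees_upto n | nodes T == n].

Lemma mem_trees n T : (T \in trees n) = (nodes T == n).
Proof.
have mem_upto h U : (height U <= h)%N -> U \in trees_upto h.
  elim: h U => [|h IHh] [|l r] //= hU; rewrite inE //=.
  move: hU; rewrite ltnS geq_max => /andP[hl hr].
  by apply/allpairsP; exists (l, r); rewrite !IHh.
have height_le U : (height U <= nodes U)%N.
  elim: U => [|l IHl r IHr] /=; first by [].
  by rewrite ltnS geq_max (leq_trans IHl (leq_addr _ _)) (leq_trans IHr (leq_addl _ _)).
rewrite mem_filter; case: eqP => //= <-; exact: mem_upto.
Qed.

Lemma uniq_trees n : uniq (trees n).
Proof.
apply: filter_uniq; elim: n => //= h IHh.
apply/andP; split; first by apply/negP => /allpairsP[[? ?] []].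
by apply: allpairs_uniq => // -[l r] [l' r'] _ _ /= [-> ->].
Qed.

Definition twin (J : tree * tree) : bool :=
  (nodes J.1 == nodes J.2) &&
  all (fun i => nth false (canopy J.1) i != nth false (canopy J.2) i)
      (iota 0 (nodes J.1).-1).

Record TBT := Tbt { trees_of :> tree * tree; trees_ofP : twin trees_of }.

HB.instance Definition _ := [isSub for trees_of].
HB.instance Definition _ := [Countable of TBT by <:].

Definition tbt_size (J : TBT) : nat := nodes J.1.

Definition tbts (n : nat) : seq TBT :=
  pmap insub [seq (L, R) | L <- trees n, R <- trees n].

Lemma mem_tbts n (J : TBT) : (J \in tbts n) = (tbt_size J == n).
Proof.
have /andP[/eqP JP _] := trees_ofP J.
rewrite /tbts mem_pmap_sub /tbt_size -[val J]/(trees_of J).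
case: (trees_of J) JP => L R /= JP; apply/allpairsP/eqP => [[[L' R']] | Ln].
  by rewrite !mem_trees => -[/eqP<- _ [-> _]].
by exists (L, R); rewrite !mem_trees -JP Ln.
Qed.

Lemma uniq_tbts n : uniq (tbts n).
Proof.
apply/pmap_sub_uniq/allpairs_uniq; try exact: uniq_trees.
by move=> [? ?] [? ?] _ _ [-> ->].
Qed.

Lemma leavesE d l r :
  leaves d (Node l r) = true :: rcons (canopy (Node l r)) false.
Proof.
have [s sP] : exists s, leaves d (Node l r) = true :: rcons s false.
  have hd T : exists s, leaves true T = true :: s.
    elim: T => [|l' [s sP] r' _] /=; first by exists [::].
    by rewrite sP; eexists.
  have tl T : exists s, leaves false T = rcons s false.
    elim: T => [|l' _ r' [s sP]] /=; first by exists [::].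
    by rewrite sP -rcons_cat; eexists.
  have [[s sP] [s' sP']] := (hd l, tl r).
  by exists (s ++ s'); rewrite /= sP sP' /= rcons_cat.
have := size_leaves d (Node l r); rewrite sP /= size_rcons => -[sz].
have -> : canopy (Node l r) = behead (take (nodes (Node l r)) (leaves d (Node l r))).
  by [].
by rewrite sP /= -sz -[in take _ _]cats1 take_size_cat.
Qed.

Lemma canopy_of d T s : leaves d T = true :: rcons s false -> canopy T = s.
Proof.
case: T => [|l r]; first by case: s.
by rewrite leavesE => -[/eqP]; rewrite eqseq_rcons andbT => /eqP.
Qed.

Lemma nodes_under T0 T1 : nodes (graft_under T0 T1) = (nodes T0 + nodes T1)%N.
Proof. by elim: T0 => //= l _ r ->; rewrite addSn addnA. Qed.

Lemma nodes_over T0 T1 : nodes (graft_over T0 T1) = (nodes T0 + nodes T1)%N.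
Proof. by elim: T1 => [|l /= -> r _] /=; rewrite ?addn0 // addnS addnA. Qed.

Lemma graft_underT0 T : graft_under T Leaf = T.
Proof. by elim: T => //= l _ r ->. Qed.

Lemma canopy_under T0 T1 : T0 != Leaf -> T1 != Leaf ->
  canopy (graft_under T0 T1) = canopy T0 ++ true :: canopy T1.
Proof.
case: T1 => // l1 r1 T0N _; set T1 := Node l1 r1.
have lE d : leaves d (graft_under T0 T1) =
    take (nodes T0) (leaves d T0) ++ leaves d T1.
  elim: T0 {T0N} d => //= l IHl r IHr d; rewrite IHr catA; congr (_ ++ _).
  by rewrite take_cat size_leaves ltnS leqNgt ltnS leq_addr /= subSS addKn.
case: T0 T0N lE => // l0 r0 _ /(_ false) lE.
apply: (@canopy_of false); rewrite lE !leavesE rcons_cat /=; congr (_ :: _).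
have := size_leaves false (Node l0 r0); rewrite leavesE => /= -[].
rewrite size_rcons => -[<-].
by rewrite -[in take _ _]cats1 take_size_cat.
Qed.

Lemma canopy_over T0 T1 : T0 != Leaf -> T1 != Leaf ->
  canopy (graft_over T0 T1) = canopy T0 ++ false :: canopy T1.
Proof.
case: T0 => // l0 r0 _; set T0 := Node l0 r0.
have lE d : leaves d (graft_over T0 T1) = leaves d T0 ++ behead (leaves d T1).
  elim: T1 d => [|l IHl r IHr] d /=; first by rewrite cats0.
  by rewrite IHl -!catA; case: (leaves true l) (size_leaves true l).
case: T1 lE => // l1 r1 /(_ false) lE _.
apply: (@canopy_of false); rewrite lE !leavesE /=.
by rewrite rcons_cat -cats1 -catA.
Qed.

Lemma size_canopy T : size (canopy T) = (nodes T).-1.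
Proof. by rewrite size_behead size_take size_leaves leqnn. Qed.

Lemma twinE J : twin J =
  (nodes J.1 == nodes J.2) && (canopy J.2 == map negb (canopy J.1)).
Proof.
rewrite /twin; have [nE|//] := eqVneq; apply/allP/eqP => [tw | -> i].
  apply: (@eq_from_nth _ false) => [|i]; first by rewrite size_map !size_canopy nE.
  rewrite size_canopy -nE => iJ; rewrite (nth_map false) ?size_canopy //.
  by have := tw i; rewrite mem_iota => /(_ iJ); do 2![case: (nth _ _ i)].
rewrite mem_iota => iJ; rewrite (nth_map false) ?size_canopy //.
by case: (nth _ _ i).
Qed.

Lemma twin_leaf J : twin J -> (J.1 == Leaf) = (J.2 == Leaf).
Proof. by case: J => [[|? ?] [|? ?]]. Qed.

Lemma graft_over0T T : graft_over Leaf T = T.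
Proof. by elim: T => //= l -> r _. Qed.

Lemma twin_graft (L0 R0 L1 R1 : tree) : twin (L0, R0) -> twin (L1, R1) ->
  twin (graft_under L0 L1, graft_over R0 R1) /\
  twin (graft_over L0 L1, graft_under R0 R1).
Proof.
move=> tw0 tw1; have [/= e0 e1] := (twin_leaf tw0, twin_leaf tw1).
have [L0E|L0N] := eqVneq L0 Leaf.
  have /eqP R0E : R0 == Leaf by rewrite -e0 L0E.
  by rewrite L0E R0E /= !graft_over0T.
have [L1E|L1N] := eqVneq L1 Leaf.
  have /eqP R1E : R1 == Leaf by rewrite -e1 L1E.
  by rewrite L1E R1E /= !graft_underT0.
have [R0N R1N] : R0 != Leaf /\ R1 != Leaf by rewrite -e0 -e1.
move: tw0 tw1; rewrite !twinE /= !nodes_under !nodes_over !canopy_under //.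
rewrite !canopy_over // => /andP[/eqP-> /eqP->] /andP[/eqP-> /eqP->].
by rewrite !map_cat /= !eqxx.
Qed.

Lemma tbt_over_subproof (J0 J1 : TBT) :
  twin (graft_under J0.1 J1.1, graft_over J0.2 J1.2).
Proof. by case: J0 J1 => [[? ?] tw0] [[? ?] tw1]; case: (twin_graft tw0 tw1). Qed.

Lemma tbt_under_subproof (J0 J1 : TBT) :
  twin (graft_over J0.1 J1.1, graft_under J0.2 J1.2).
Proof. by case: J0 J1 => [[? ?] tw0] [[? ?] tw1]; case: (twin_graft tw0 tw1). Qed.

(* J0 / J1 and J0 \ J1: on left trees the opposite grafting is used. *)
Definition tbt_over (J0 J1 : TBT) : TBT := Tbt (tbt_over_subproof J0 J1).

Definition tbt_under (J0 J1 : TBT) : TBT := Tbt (tbt_under_subproof J0 J1).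

Inductive ltree := LLeaf | LNode of ltree & nat & ltree.

Fixpoint unlabel (T : ltree) : tree :=
  if T is LNode l _ r then Node (unlabel l) (unlabel r) else Leaf.

Fixpoint leaf_insert (a : nat) (T : ltree) : ltree :=
  if T is LNode l x r then
    if (a < x)%N then LNode (leaf_insert a l) x r else LNode l x (leaf_insert a r)
  else LNode LLeaf a LLeaf.

(* The trees T_{<= a} and T_{> a}, for a binary search tree T; lemmas [cut_leP],
   [cut_gtP] and [is_cut_uniq] show that they are the only binary search trees
   satisfying their defining property [is_cut]. *)
Fixpoint cut_le (a : nat) (T : ltree) : ltree :=
  if T is LNode l x r then
    if (x <= a)%N then LNode l x (cut_le a r) else cut_le a l
  else LLeaf.

Fixpoint cut_gt (a : nat) (T : ltree) : ltree :=
  if T is LNode l x r then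
    if (x <= a)%N then cut_gt a r else LNode (cut_gt a l) x r
  else LLeaf.

Definition root_insert (a : nat) (T : ltree) : ltree :=
  LNode (cut_le a T) a (cut_gt a T).

Fixpoint labels (T : ltree) : seq nat :=
  if T is LNode l x r then labels l ++ x :: labels r else [::].

Definition is_bst (T : ltree) : bool := sorted ltn (labels T).

(* The node labeled x is a strict ancestor of the node labeled y. *)
Fixpoint ancestor (T : ltree) (x y : nat) : bool :=
  if T is LNode l z r then
    [|| (x == z) && (y \in labels l ++ labels r), ancestor l x y | ancestor r x y]
  else false.

Definition is_cut (p : pred nat) (T T' : ltree) : Prop :=
  [/\ is_bst T', labels T' =i [seq x <- labels T | p x]
    & forall x y, ancestor T' x y -> ancestor T x y].

Lemma is_bst_node l x r : is_bst (LNode l x r) =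
  [&& is_bst l, is_bst r, all (ltn^~ x) (labels l) & all (ltn x) (labels r)].
Proof.
rewrite /is_bst !(sorted_pairwise ltn_trans) /= pairwise_cat /=.
apply/and3P/and4P => [[lr sl /andP[xr sr]]|[sl sr lx xr]].
  split=> //; apply/allP => y yl; move/allrelP: lr; apply=> //.
  by rewrite inE eqxx.
split; rewrite ?xr //; apply/allrelP => y z /(allP lx) yx.
by rewrite inE => /orP[/eqP->//|/(allP xr)]; apply: ltn_trans.
Qed.

Lemma cut_labels a T : is_bst T ->
  labels (cut_le a T) = [seq x <- labels T | (x <= a)%N] /\
  labels (cut_gt a T) = [seq x <- labels T | (a < x)%N].
Proof.
elim: T => //= l IHl x r IHr; rewrite is_bst_node => /and4P[sl sr lx xr].
have [[ll lg] [rl rg]] := (IHl sl, IHr sr); rewrite !filter_cat /=.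
have filter_none (p : pred nat) s : all (predC p) s -> [seq y <- s | p y] = [::].
  by rewrite all_predC has_filter negbK => /eqP.
case: (leqP x a) => xa /=.
  rewrite rl rg (_ : [seq y <- labels l | (y <= a)%N] = labels l); last first.
    by apply/all_filterP/allP => y /(allP lx) /ltnW/leq_trans; apply.
  rewrite (_ : [seq y <- labels l | (a < y)%N] = [::]) //.
  apply: filter_none; apply/allP => y /(allP lx) /ltnW/leq_trans/(_ xa) /=.
  by rewrite -leqNgt.
rewrite ll lg (_ : [seq y <- labels r | (a < y)%N] = labels r); last first.
  by apply/all_filterP/allP => y /(allP xr); apply: ltn_trans.
rewrite (_ : [seq y <- labels r | (y <= a)%N] = [::]) ?cats0 //.
apply: filter_none; apply/allP => y /(allP xr) /(ltn_trans xa) /=.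
by rewrite -ltnNge.
Qed.

Lemma ancestor_labels T x y :
  ancestor T x y -> x \in labels T /\ y \in labels T.
Proof.
elim: T => //= l IHl z r IHr; rewrite !mem_cat !inE.
by case/or3P => [/andP[-> /orP[]->]|/IHl[-> ->]|/IHr[-> ->]]; rewrite ?orbT.
Qed.

Lemma cut_leP a T : is_bst T -> is_cut (leq^~ a) T (cut_le a T).
Proof.
move=> bT; have [lE _] := cut_labels a bT; split; rewrite ?lE //.
  by rewrite /is_bst lE; apply: sorted_filter => //; apply: ltn_trans.
move=> x y {lE}; elim: T bT => //= l IHl z r IHr.
rewrite is_bst_node => /and4P[bl br _ _].
case: leqP => _ /=; last by move/(IHl bl) ->; rewrite orbT.
case/or3P => [/andP[-> ]|->|/(IHr br)->]; rewrite ?orbT //.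
rewrite !mem_cat (cut_labels a br).1 mem_filter.
by case/orP => [->|/andP[_ ->]]; rewrite ?orbT.
Qed.

Lemma cut_gtP a T : is_bst T -> is_cut (ltn a) T (cut_gt a T).
Proof.
move=> bT; have [_ lE] := cut_labels a bT; split; rewrite ?lE //.
  by rewrite /is_bst lE; apply: sorted_filter => //; apply: ltn_trans.
move=> x y {lE}; elim: T bT => //= l IHl z r IHr.
rewrite is_bst_node => /and4P[bl br _ _].
case: leqP => _ /=; first by move/(IHr br) ->; rewrite !orbT.
case/or3P => [/andP[-> ]|/(IHl bl)->|->]; rewrite ?orbT //.
rewrite !mem_cat (cut_labels a bl).2 mem_filter.
by case/orP => [/andP[_ ->]|->]; rewrite ?orbT.
Qed.

Lemma ancestor_asym T x y : is_bst T -> ancestor T x y -> ~ ancestor T y x.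
Proof.
elim: T => //= l IHl z r IHr; rewrite is_bst_node => /and4P[bl br lz zr].
have lN u : u \in labels l -> u != z.
  by move=> /(allP lz) uz; apply: contraTneq uz => ->; rewrite /= ltnn.
have rN u : u \in labels r -> u != z.
  by move=> /(allP zr) uz; apply: contraTneq uz => ->; rewrite /= ltnn.
have lrN u : u \in labels l -> u \in labels r -> False.
  by move=> /(allP lz) uz /(allP zr) /(ltn_trans uz); rewrite ltnn.
have lrz u : u \in labels l ++ labels r -> u != z.
  by rewrite mem_cat => /orP[/lN|/rN].
case/or3P => [/andP[/eqP-> /lrz yz]|xy|xy] /or3P[/andP[/eqP yE]|yx|yx].
- by rewrite yE eqxx in yz.
- by have [_ /lN] := ancestor_labels yx; rewrite eqxx.
- by have [_ /rN] := ancestor_labels yx; rewrite eqxx.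
- by have [_ /lN] := ancestor_labels xy; rewrite yE eqxx.
- exact: IHl yx.
- by have [/lrN h _] := ancestor_labels xy; have [_ /h] := ancestor_labels yx.
- by have [_ /rN] := ancestor_labels xy; rewrite yE eqxx.
- by have [h _] := ancestor_labels xy; have [_ /lrN/(_ h)] := ancestor_labels yx.
- exact: IHr yx.
Qed.

Lemma is_cut_uniq p T T1 T2 :
  is_bst T -> is_cut p T T1 -> is_cut p T T2 -> T1 = T2.
Proof.
move=> bT [b1 l1 a1] [b2 l2 a2].
have {l1 l2} l12 : labels T1 =i labels T2 by move=> x; rewrite l1 l2.
have asym x y : ancestor T1 x y -> ancestor T2 y x -> False.
  by move=> /a1 + /a2; apply: ancestor_asym.
have {a1 a2 bT} := asym.
elim: T1 T2 b1 b2 l12 {asym} => [|u1 IHu x1 v1 IHv] [|u2 x2 v2] b1 b2 l12 asym //.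
- by have := l12 x2; rewrite /= mem_cat mem_head orbT.
- by have := l12 x1; rewrite /= mem_cat mem_head orbT.
have x12 : x1 = x2.
  apply/eqP/negP => /negP x12; apply: (asym x1 x2) => /=.
    have := l12 x2; rewrite /= !mem_cat !inE eqxx orbT eq_sym (negPf x12) /=.
    by rewrite eqxx => ->.
  have := l12 x1; rewrite /= !mem_cat !inE !eqxx orbT (negPf x12) /=.
  by move=> <-.
move: b1 b2; rewrite -x12 in l12 asym *; rewrite !is_bst_node.
move=> /and4P[bu1 bv1 ux1 xv1] /and4P[bu2 bv2 ux2 xv2].
have uE u v : all (ltn^~ x1) (labels u) -> all (ltn x1) (labels v) ->
    labels u =i [pred y in labels (LNode u x1 v) | (y < x1)%N] /\
    labels v =i [pred y in labels (LNode u x1 v) | (x1 < y)%N].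
  move=> /allP ux /allP xv.
  by split=> y; rewrite [in RHS]inE /= mem_cat in_cons;
    move: (ux y) (xv y) => /=; case: (y \in labels u); case: (y \in labels v);
    case: (ltngtP y x1) => //= _ hu hv; by [have := hu isT | have := hv isT].
have [[u1E v1E] [u2E v2E]] := (uE _ _ ux1 xv1, uE _ _ ux2 xv2).
congr LNode.
  apply: IHu => // [y|x y xy yx]; first by rewrite u1E u2E !inE l12.
  by apply: (asym x y); rewrite /= ?xy ?yx !orbT.
apply: IHv => // [y|x y xy yx]; first by rewrite v1E v2E !inE l12.
by apply: (asym x y); rewrite /= ?xy ?yx !orbT.
Qed.

Definition insert_pair (TT : ltree * ltree) (a : nat) : ltree * ltree :=
  (leaf_insert a TT.1, root_insert a TT.2).

Definition P_symbol (s : permut) : tree * tree :=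
  let: (TL, TR) := foldl insert_pair (LLeaf, LLeaf) s in (unlabel TL, unlabel TR).

Definition tbt_le (J0 J1 : TBT) : Prop :=
  exists s0 s1 : permut,
    [/\ P_symbol s0 = J0, P_symbol s1 = J1 & perm_le s0 s1].

Notation FQSym K := {malg K[permut]}.

Section Baxter.

Variable K : fieldType.

Definition fqF (s : permut) : FQSym K := << s >>.

(* The bilinear extension of F_s . F_t = sum of the shifted shuffles. *)
Definition fqmul (x y : FQSym K) : FQSym K :=
  \sum_(s <- msupp x) \sum_(t <- msupp y)
    (x@_s * y@_t) *: \sum_(p <- shifted_shuffle s t) fqF p.

Lemma fqmulFF s t : fqmul (fqF s) (fqF t) = \sum_(p <- shifted_shuffle s t) fqF p.
Proof.
by rewrite /fqmul !msuppU oner_eq0 !big_seq_fset1 !mcoeffUU mulr1 scale1r.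
Qed.

Definition baxterP (J : TBT) : FQSym K :=
  \sum_(s <- permuts (tbt_size J) | P_symbol s == J) fqF s.

Definition baxterE (J : TBT) : FQSym K :=
  \sum_(J' <- tbts (tbt_size J) | `[< tbt_le J J' >]) baxterP J'.

Definition baxterH (J : TBT) : FQSym K :=
  \sum_(J' <- tbts (tbt_size J) | `[< tbt_le J' J >]) baxterP J'.

End Baxter.

(* Main.v *)
From Stdlib Require Import Relation_Operators.
Require Import Defs.
From mathcomp Require Import all_boot all_order all_algebra.
From mathcomp Require Import finmap boolp monalg.
From mathcomp Require Import zify.
Import GRing.Theory.
Local Open Scope ring_scope.

(** Both sides of each identity are multiplicity-free sums of the F_s, so the
    identities are statements about sets of permutations.

    Root insertion read from left to right is leaf insertion read from right to
    left ([root_insert_search_tree]).  Hence P(s) is the pair formed by the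
    shapes of the leaf-insertion search trees of the word s and of its reversal;
    reversing s exchanges the two trees and reverses the permutohedron order,
    and the identity for H is the mirror image of the identity for E.

    The permutohedron order is inclusion of inversion sets ([perm_leP]).  The
    crucial point is that a relation u <= v can be transported along the class
    of v: if P(v) = P(w), then some u' with P(u') = P(u) satisfies u' <= w
    ([weak_le_class]).  Indeed, if b > a is an inversion of u but not of w, then
    a and b are unrelated in both search trees of w, so that some letter between
    a and b in value comes before them and another one comes after them; this
    makes it possible to undo an adjacent descent of u without changing P(u).
    As the sum over the J' in E_J runs over P(s) for all s (which requires P(s)
    to be a pair of twin trees, [twin_insertion_pair]), it follows that E_J is
    the sum of the F_s such that s >= u for some u with P(u) = J.

    A permutation p of size n + m occurs in exactly one shifted shuffle of a
    permutation of size n and one of size m, namely those given by its letters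
    at most n and its letters above n ([mem_shifted_shuffle]).  So what remains
    is that p lies above the class of J0 / J1 if and only if its two parts lie
    above the classes of J0 and J1 ([above_class_over]).  From left to right,
    restriction to the letters at most n, or above n, preserves the order and
    cuts each search tree ([cut_le_search_tree], [cut_gt_search_tree]), which
    undoes the graft.  From right to left, concatenating u0 and the shifted u1
    grafts the trees ([insertion_pair_cat]) and creates no inversion between
    small and large letters. *)

Set Implicit Arguments.
Unset Strict Implicit.
Unset Printing Implicit Defensive.

Local Open Scope nat_scope.

(** * Precedence of letters in a word *)

Definition prec (w : seq nat) (a b : nat) : bool := subseq [:: a; b] w.

Lemma prec_mem w a b : prec w a b -> (a \in w) /\ (b \in w).
Proof. by move=> /mem_subseq ab; rewrite !ab ?inE ?eqxx ?orbT. Qed.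

Lemma prec_rev w a b : prec (rev w) a b = prec w b a.
Proof. by rewrite /prec -subseq_rev revK. Qed.

Lemma prec_filter (p : pred nat) w a b :
  prec (filter p w) a b = [&& p a, p b & prec w a b].
Proof. by rewrite /prec subseq_filter /= andbT andbA. Qed.

Lemma prec_index w a b : uniq w ->
  prec w a b = (index a w < index b w < size w).
Proof.
rewrite /prec; elim: w => [|x w IHw] // /andP[xw uw].
move/(_ uw): IHw => IHw.
rewrite /=; case: (eqVneq a x) => [_|nax] /=.
  rewrite sub1seq; case: (eqVneq x b) => [<-|nxb].
    by rewrite (negPf xw) ltnn.
  by rewrite ltn0Sn ltnS index_mem.
rewrite IHw; case: (eqVneq x b) => [<-|nxb]; last by rewrite !ltnS.
by move: xw; rewrite ltn0 -index_mem /= => /negPf->; rewrite andbF.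
Qed.

Lemma prec_asym w a b : uniq w -> prec w a b -> ~~ prec w b a.
Proof. by move=> uw; rewrite !prec_index //; lia. Qed.

Lemma prec_trans w a b c : uniq w -> prec w a b -> prec w b c -> prec w a c.
Proof. by move=> uw; rewrite !prec_index //; lia. Qed.

Lemma prec_total w a b : uniq w -> a \in w -> b \in w -> a != b ->
  prec w a b || prec w b a.
Proof.
move=> uw aw bw ab; rewrite !prec_index //.
have nE : index a w != index b w.
  by apply: contraNneq ab => e; rewrite -(nth_index a aw) e nth_index.
by rewrite -index_mem in aw; rewrite -index_mem in bw; lia.
Qed.

Lemma prec_cons x w a b :
  prec (x :: w) a b = (a == x) && (b \in w) || prec w a b.
Proof.
rewrite /prec /=; case: eqVneq => [->|_] //=; rewrite sub1seq.
case: (boolP (b \in w)) => //= bw.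
by apply/esym/negbTE; apply: contra bw => /prec_mem[].
Qed.

Lemma prec_cat u v a b :
  prec (u ++ v) a b = [|| prec u a b, prec v a b | (a \in u) && (b \in v)].
Proof.
elim: u => [|x u IHu] /=; first by rewrite orbF.
rewrite !prec_cons IHu mem_cat inE.
by case: (a == x); case: (prec u a b); case: (b \in u); case: (b \in v);
  case: (prec v a b); case: (a \in u).
Qed.

Lemma precP w a b : prec w a b ->
  exists p q r, w = p ++ a :: q ++ b :: r.
Proof.
elim: w => //= x w IHw; rewrite /prec /=.
case: eqP => [<-|_ /IHw[p [q [r ->]]]]; last by exists (x :: p), q, r.
rewrite sub1seq => /splitPr[q r]; by exists [::], q, r.
Qed.

(** Exchanging two adjacent letters only affects their own precedence. *)
Lemma prec_swap u v a b x y : (x, y) != (a, b) ->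
  prec (u ++ [:: a, b & v]) x y -> prec (u ++ [:: b, a & v]) x y.
Proof.
rewrite xpair_eqE !prec_cat !prec_cons !inE.
by case: (x == a); case: (y == b) => //= _; case: (prec u x y) => //=;
  case: (prec v x y) => //=; rewrite ?orbT //; case: (x \in u) => //=;
  case: (x == b); case: (y == a); case: (y \in v).
Qed.

(** * The permutohedron order as inclusion of inversions *)

Definition weak_le (u v : seq nat) : Prop :=
  perm_eq u v /\ forall a b, a < b -> prec u b a -> prec v b a.

Lemma weak_le_refl u : weak_le u u.
Proof. by split. Qed.

Lemma weak_le_trans v u w : weak_le u v -> weak_le v w -> weak_le u w.
Proof.
move=> [puv uv] [pvw vw]; split; first exact: perm_trans puv pvw.
by move=> a b ab /(uv _ _ ab)/(vw _ _ ab).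
Qed.

Lemma weak_le_prec u v a b : uniq v -> weak_le u v ->
  a < b -> prec v a b -> prec u a b.
Proof.
move=> uv [puv inv] ab vab; have [av bv] := prec_mem vab.
have := @prec_total u a b; rewrite (perm_uniq puv) !(perm_mem puv) => /(_ uv av bv).
rewrite neq_ltn ab => /(_ isT)/orP[//|/(inv _ _ ab)].
by move=> /(prec_asym uv); rewrite vab.
Qed.

Lemma weak_le_rev u v : uniq v -> weak_le u v -> weak_le (rev v) (rev u).
Proof.
move=> uv le_uv; split.
  by rewrite perm_rev perm_sym perm_rev; case: le_uv.
by move=> a b ab; rewrite !prec_rev; apply: weak_le_prec.
Qed.

Lemma weak_le_filter (p : pred nat) u v :
  weak_le u v -> weak_le (filter p u) (filter p v).
Proof.
move=> [puv inv]; split=> [|a b ab]; first exact: perm_filter.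
by rewrite !prec_filter => /and3P[-> -> /(inv _ _ ab)].
Qed.

Lemma prec_shift n w a b :
  prec [seq x + n | x <- w] (a + n) (b + n) = prec w a b.
Proof.
elim: w => // x w IHw; rewrite /= !prec_cons IHw eqn_add2r.
by rewrite (mem_map (@addIn n)).
Qed.

Lemma weak_le_shift n u v :
  weak_le [seq x + n | x <- u] [seq x + n | x <- v] -> weak_le u v.
Proof.
move=> [puv inv]; split; first exact: perm_map_inj (@addIn n) _ _ puv.
by move=> a b ab; rewrite -(prec_shift n u) -(prec_shift n v); apply: inv; rewrite ltn_add2r.
Qed.

(** The covering relation on bare words: the words met while sorting the tail
    of a permutation are not permutations themselves. *)
Definition word_cover (u v : seq nat) : Prop :=
  exists (p q : seq nat) (a b : nat),
    [/\ a < b, u = p ++ [:: a, b & q] & v = p ++ [:: b, a & q]].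

Lemma swap_perm (p q : seq nat) a b :
  perm_eq (p ++ [:: a, b & q]) (p ++ [:: b, a & q]).
Proof. by rewrite perm_cat2l (perm_catCA [:: a] [:: b]). Qed.

Lemma weak_le_swap p q a b : a < b ->
  weak_le (p ++ [:: a, b & q]) (p ++ [:: b, a & q]).
Proof.
move=> ab; split=> [|x y xy]; first exact: swap_perm.
by apply: prec_swap; rewrite xpair_eqE; apply/negP => /andP[/eqP ? /eqP ?]; lia.
Qed.

Notation word_chain := (clos_refl_trans (seq nat) word_cover).

Lemma word_chain_cons x u v : word_chain u v -> word_chain (x :: u) (x :: v).
Proof.
elim=> [{}u {}v [p [q [a [b [ab -> ->]]]]]|w|{}u w {}v _ uw _ wv].
- by apply: rt_step; exists (x :: p), q, a, b.
- exact: rt_refl.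
- exact: rt_trans uw wv.
Qed.

(** A letter is brought to the front by successive exchanges with the smaller
    letters on its left. *)
Lemma word_chain_front a u v : all (ltn^~ a) u ->
  word_chain (u ++ a :: v) (a :: u ++ v).
Proof.
elim: u => [_|x u IHu /= /andP[xa ua]]; first exact: rt_refl.
apply: rt_trans (word_chain_cons x (IHu ua)) _.
by apply: rt_step; exists [::], (u ++ v), x, a.
Qed.

(** The first letter a of v is preceded in u only by smaller letters, since a
    larger one would be an inversion of u that v lacks; so a can be moved to the
    front of u, and the rest follows by induction. *)
Lemma weak_le_chain u v : uniq v -> weak_le u v -> word_chain u v.
Proof.
elim: v u => [|a v IHv] u uv [puv inv].
  by rewrite (perm_nilP puv); apply: rt_refl.
have au : a \in u by rewrite (perm_mem puv) mem_head.
case/splitPr: au puv inv => p q puv inv.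
have uu : uniq (p ++ a :: q) by rewrite (perm_uniq puv).
have pqv : perm_eq (p ++ q) v.
  by rewrite -(perm_cons a) -(perm_catCA p [:: a] q).
have /andP[apq upq] : uniq (a :: p ++ q).
  by rewrite -(perm_uniq (permEl (perm_catCA p [:: a] q))).
have av : a \notin v by case/andP: uv.
apply: rt_trans (word_chain_front _ _) _.
  apply/allP => x xp /=; rewrite ltnNge leq_eqVlt; apply/negP => /orP[/eqP ax|ax].
    by move: apq; rewrite mem_cat ax xp.
  have /(inv _ _ ax) : prec (p ++ a :: q) x a.
    by rewrite prec_cat xp mem_head !orbT.
  rewrite prec_cons (negPf av) andbF => /prec_mem[_].
  by rewrite (negPf av).
apply/word_chain_cons/IHv; first by case/andP: uv.
split=> // b c bc cb.
have /(inv _ _ bc) : prec (p ++ a :: q) c b.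
  move: cb; rewrite !prec_cat prec_cons in_cons.
  by case/or3P => [->|->|/andP[-> ->]]; rewrite ?orbT.
rewrite prec_cons => /orP[/andP[/eqP ca _]|//].
by have [] := prec_mem cb; rewrite ca (negPf apq).
Qed.

Lemma word_chain_perm_le u v : word_chain u v -> forall uP : is_permut u,
  exists vP : is_permut v, perm_le (Permut uP) (Permut vP).
Proof.
elim=> [{}u {}v [p [q [a [b [ab uE vE]]]]]|w|{}u w {}v _ IHu _ IHw] uP.
- have vP : is_permut v.
    have puv : perm_eq u v by rewrite uE vE swap_perm.
    by rewrite /is_permut -(perm_size puv) -(permPl puv).
  by exists vP; apply: rt_step; exists p, q, a, b.
- by exists uP; apply: rt_refl.
- have [wP uw] := IHu uP; have [vP wv] := IHw wP.
  by exists vP; apply: rt_trans uw wv.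
Qed.

Lemma permut_uniq (s : permut) : uniq s.
Proof. by rewrite (perm_uniq (wordP s)) iota_uniq. Qed.

Lemma perm_leP (s t : permut) : perm_le s t <-> weak_le s t.
Proof.
split.
  elim=> [{}s {}t [p [q [a [b [ab sE tE]]]]]|w|{}s w {}t _ sw _ wt].
  - by rewrite sE tE; apply: weak_le_swap.
  - exact: weak_le_refl.
  - exact: weak_le_trans sw wt.
move=> /(weak_le_chain (permut_uniq t))/word_chain_perm_le/(_ (wordP s)) [tP].
have -> : Permut (wordP s) = s by apply: val_inj.
by have -> : Permut tP = t by apply: val_inj.
Qed.

(** * Search trees of words *)

Definition search_tree (w : seq nat) : ltree :=
  foldl (fun T a => leaf_insert a T) LLeaf w.

Lemma search_tree_rcons w a :
  search_tree (rcons w a) = leaf_insert a (search_tree w).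
Proof. by rewrite /search_tree -cats1 foldl_cat. Qed.

Lemma leaf_insert_labels a T : perm_eq (labels (leaf_insert a T)) (a :: labels T).
Proof.
elim: T => //= l /permP IHl x r /permP IHr.
by apply/permP => p; case: ltnP => _ /=; rewrite !count_cat /= ?IHl ?IHr /=; lia.
Qed.

Lemma search_tree_labels w : perm_eq (labels (search_tree w)) w.
Proof.
elim/last_ind: w => // w a IHw; rewrite search_tree_rcons.
by rewrite (permPl (leaf_insert_labels _ _)) perm_sym perm_rcons perm_cons perm_sym.
Qed.

Lemma leaf_insert_bst a T :
  a \notin labels T -> is_bst T -> is_bst (leaf_insert a T).
Proof.
elim: T => //= l IHl x r IHr; rewrite mem_cat inE !negb_or => /and3P[al nax ar].
rewrite is_bst_node => /and4P[bl br lx xr].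
case: ltnP => ax; rewrite is_bst_node.
  rewrite IHl // br xr andbT (perm_all _ (leaf_insert_labels _ _)) /=.
  by rewrite ax lx.
rewrite bl IHr // lx (perm_all _ (leaf_insert_labels _ _)) /= xr andbT.
by rewrite ltn_neqAle eq_sym nax.
Qed.

Lemma search_tree_bst w : uniq w -> is_bst (search_tree w).
Proof.
elim/last_ind: w => // w a IHw; rewrite rcons_uniq search_tree_rcons.
move=> /andP[aw /IHw]; apply: leaf_insert_bst.
by rewrite (perm_mem (search_tree_labels w)).
Qed.

Lemma labels_search_tree u v : uniq u -> perm_eq u v ->
  labels (search_tree u) = labels (search_tree v).
Proof.
move=> uu puv; apply: (irr_sorted_eq ltn_trans ltnn).
- exact: search_tree_bst.
- by apply: search_tree_bst; rewrite -(perm_uniq puv).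
by move=> x; rewrite !(perm_mem (search_tree_labels _)) (perm_mem puv).
Qed.

Lemma labels_search_tree_iota n w : perm_eq w (iota 1 n) ->
  labels (search_tree w) = iota 1 n.
Proof.
move=> pw; apply: (irr_sorted_eq ltn_trans ltnn).
- by apply: search_tree_bst; rewrite (perm_uniq pw) iota_uniq.
- exact: iota_ltn_sorted.
by move=> x; rewrite (perm_mem (search_tree_labels _)) (perm_mem pw).
Qed.

Lemma size_labels T : size (labels T) = nodes (unlabel T).
Proof. by elim: T => //= l IHl x r IHr; rewrite size_cat /= IHl IHr addnS. Qed.

(** The labels are listed in infix order, so they fill a given shape in only one
    way. *)
Lemma ltree_eq T1 T2 : unlabel T1 = unlabel T2 -> labels T1 = labels T2 -> T1 = T2.
Proof.
elim: T1 T2 => [|l1 IHl x1 r1 IHr] [|l2 x2 r2] //= [ul ur] /eqP.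
rewrite eqseq_cat ?size_labels ?ul // => /andP[/eqP ll].
by rewrite eqseq_cons => /andP[/eqP-> /eqP lr]; rewrite (IHl _ ul ll) (IHr _ ur lr).
Qed.

Lemma ltree_of T s : size s = nodes T -> exists2 X, unlabel X = T & labels X = s.
Proof.
elim: T s => [|l IHl r IHr] s /= sz.
  by exists LLeaf => //; rewrite (size0nil sz).
have [X Xl Xs] : exists2 X, unlabel X = l & labels X = take (nodes l) s.
  by apply: IHl; rewrite size_takel ?sz; lia.
have [Y Yr Ys] : exists2 X, unlabel X = r & labels X = drop (nodes l).+1 s.
  by apply: IHr; rewrite size_drop sz; lia.
exists (LNode X (nth 0 s (nodes l)) Y) => /=; first by rewrite Xl Yr.
by rewrite Xs Ys -drop_nth ?cat_take_drop // sz; lia.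
Qed.

(** Letters on one side of the threshold n never influence how the letters on
    the other side are placed by leaf insertion. *)
Lemma cut_le_insert n a T : cut_le n (leaf_insert a T) =
  if a <= n then leaf_insert a (cut_le n T) else cut_le n T.
Proof.
elim: T => /= [|l IHl x r IHr]; first by case: (a <= n).
case: (ltnP a x) => ax /=; case: (leqP x n) => xn //=.
- by rewrite (leq_trans (ltnW ax) xn) /= ax.
- by rewrite IHr; case: (a <= n) => //=; rewrite ltnNge ax.
- by rewrite leqNgt (leq_trans xn ax).
Qed.

Lemma cut_gt_insert n a T : cut_gt n (leaf_insert a T) =
  if n < a then leaf_insert a (cut_gt n T) else cut_gt n T.
Proof.
elim: T => /= [|l IHl x r IHr]; first by rewrite leqNgt; case: (n < a).
case: (ltnP a x) => ax /=; case: (leqP x n) => xn //=.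
- by rewrite ltnNge (leq_trans (ltnW ax) xn).
- by rewrite IHl; case: (n < a) => //=; rewrite ax.
- by rewrite (leq_trans xn ax) /= ltnNge ax.
Qed.

Lemma cut_le_search_tree n w :
  cut_le n (search_tree w) = search_tree [seq x <- w | x <= n].
Proof.
elim/last_ind: w => // w a IHw.
rewrite search_tree_rcons cut_le_insert IHw filter_rcons.
by case: leqP; rewrite ?search_tree_rcons.
Qed.

Lemma cut_gt_search_tree n w :
  cut_gt n (search_tree w) = search_tree [seq x <- w | n < x].
Proof.
elim/last_ind: w => // w a IHw.
rewrite search_tree_rcons cut_gt_insert IHw filter_rcons.
by case: ltnP; rewrite ?search_tree_rcons.
Qed.

(** The new root a splits the tree at the value a, and a leaf insertion on one
    side of a commutes with the splitting. *)
Lemma leaf_root_insertC a b T : a != b ->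
  leaf_insert b (root_insert a T) = root_insert a (leaf_insert b T).
Proof.
move=> nab; rewrite /root_insert /= cut_le_insert cut_gt_insert.
by case: ltngtP nab => //=.
Qed.

Lemma root_insert_search_tree a w : a \notin w ->
  root_insert a (search_tree w) = search_tree (a :: w).
Proof.
elim/last_ind: w => // w b IHw.
rewrite -rcons_cons !search_tree_rcons mem_rcons inE negb_or => /andP[nab aw].
by rewrite -leaf_root_insertC // IHw.
Qed.

(** The twin trees of w, with the right tree expressed by leaf insertion. *)
Definition insertion_pair (w : seq nat) : tree * tree :=
  (unlabel (search_tree w), unlabel (search_tree (rev w))).

Lemma P_symbolE (s : permut) : P_symbol s = insertion_pair s.
Proof.
rewrite /P_symbol /insertion_pair.
have : uniq s by exact: permut_uniq.
elim/last_ind: (word s) => [//|w a IHw]; rewrite rcons_uniq => /andP[aw uw].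
suff fE u : uniq u ->
    foldl insert_pair (LLeaf, LLeaf) u = (search_tree u, search_tree (rev u)).
  by rewrite fE // rcons_uniq aw.
elim/last_ind: u {IHw aw uw a w} => // u b IHu; rewrite rcons_uniq => /andP[bu uu].
rewrite -cats1 foldl_cat IHu //= /insert_pair /= root_insert_search_tree.
  by rewrite cats1 search_tree_rcons rev_rcons.
by rewrite mem_rev.
Qed.

Definition swap_pair (J : tree * tree) : tree * tree := (J.2, J.1).

Lemma insertion_pair_rev w : insertion_pair (rev w) = swap_pair (insertion_pair w).
Proof. by rewrite /insertion_pair revK. Qed.

(** * Ancestors and precedence *)

Lemma ancestor_leaf_insert a T x y : ancestor (leaf_insert a T) x y ->
  ancestor T x y || (x \in labels T) && (y == a).
Proof.
elim: T => /= [|l IHl z r IHr]; first by rewrite andbF.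
case: ltnP => _ /=; rewrite !mem_cat in_cons (perm_mem (leaf_insert_labels _ _)) in_cons.
  case/or3P => [/andP[->]|/IHl/orP[->|/andP[-> ->]]|->]; rewrite ?orbT //.
  by case/orP => [/orP[]->|->]; rewrite ?orbT.
case/or3P => [/andP[->]|->|/IHr/orP[->|/andP[-> ->]]]; rewrite ?orbT //.
by case/or3P => ->; rewrite ?orbT.
Qed.

Lemma ancestor_prec w x y : ancestor (search_tree w) x y -> prec w x y.
Proof.
elim/last_ind: w => // w a IHw; rewrite search_tree_rcons -cats1 prec_cat.
move=> /ancestor_leaf_insert/orP[/IHw->//|].
by rewrite (perm_mem (search_tree_labels w)) inE => ->; rewrite !orbT.
Qed.

(** Two unrelated nodes are separated by their lowest common ancestor. *)
Lemma bst_ancestor T x y : is_bst T ->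
  x \in labels T -> y \in labels T -> x < y ->
  [\/ ancestor T x y, ancestor T y x |
     exists z, [/\ x < z, z < y, ancestor T z x & ancestor T z y]].
Proof.
elim: T => //= l IHl z r IHr; rewrite is_bst_node => /and4P[bl br /allP lz /allP zr].
rewrite !mem_cat !inE => /or3P[xl|/eqP->|xr] /or3P[yl|/eqP->|yr] xy.
- have [->|->|[t [xt ty tx ty']]] := IHl bl xl yl xy.
  + by constructor 1; rewrite orbT.
  + by constructor 2; rewrite orbT.
  by constructor 3; exists t; rewrite xt ty tx ty' !orbT.
- by constructor 2; rewrite eqxx xl.
- constructor 3; exists z; split; [exact: lz | exact: zr | |].
    by rewrite eqxx xl.
  by rewrite eqxx yr orbT.
- by have := lz _ yl => /= yz; lia.
- lia.
- by constructor 1; rewrite eqxx yr orbT.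
- by have := lz _ yl; have := zr _ xr => /=; lia.
- by have := zr _ xr => /=; lia.
- have [->|->|[t [xt ty tx ty']]] := IHr br xr yr xy.
  + by constructor 1; rewrite !orbT.
  + by constructor 2; rewrite !orbT.
  by constructor 3; exists t; rewrite xt ty tx ty' !orbT.
Qed.

(** Two words with the same search tree that order a and b differently: neither
    letter is an ancestor of the other, and the separating ancestor was inserted
    before both. *)
Lemma same_tree_separator u v a b : uniq u -> uniq v ->
  search_tree u = search_tree v -> a < b ->
  prec u a b && prec v b a || prec u b a && prec v a b ->
  exists z, [/\ a < z < b, prec v z a & prec v z b].
Proof.
move=> uu uv euv ab abP.
have [av bv] : a \in v /\ b \in v.
  by case/orP: abP => /andP[_ /prec_mem[]].
have := @bst_ancestor (search_tree v) a b.
rewrite search_tree_bst // !(perm_mem (search_tree_labels v)).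
case/(_ isT av bv ab) => [anc|anc|[z [az zb za zzb]]].
- have := ancestor_prec anc; rewrite -euv in anc; have := ancestor_prec anc.
  by case/orP: abP => /andP[] => [_ /(prec_asym uv)|/(prec_asym uu)] /negPf->.
- have := ancestor_prec anc; rewrite -euv in anc; have := ancestor_prec anc.
  by case/orP: abP => /andP[] => [/(prec_asym uu)|_ /(prec_asym uv)] /negPf->.
- by exists z; rewrite az zb; split=> //; apply: ancestor_prec.
Qed.

(** Once x separates a from b, the two insertions take place in disjoint
    subtrees of the node labeled x. *)
Lemma leaf_insertC a x b T : is_bst T -> x \in labels T -> a < x < b ->
  leaf_insert a (leaf_insert b T) = leaf_insert b (leaf_insert a T).
Proof.
move=> + + /andP[ax xb].
elim: T => //= l IHl z r IHr; rewrite is_bst_node => /and4P[bl br /allP lz /allP zr].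
rewrite mem_cat inE.
case: (ltnP b z) => bz xT.
  have az : a < z by lia.
  rewrite /= az /= bz IHl //.
  by case/or3P: xT => [//|/eqP|/zr /=]; lia.
have bzF : (b < z) = false by lia.
case: (ltnP a z) => az; first by rewrite /= bzF az.
have azF : (a < z) = false by lia.
rewrite /= azF /= bzF IHr //.
by case/or3P: xT => [/lz /=|/eqP|//]; lia.
Qed.

Lemma search_tree_swap u v x a b : uniq u -> x \in u -> a < x < b ->
  search_tree (u ++ [:: a, b & v]) = search_tree (u ++ [:: b, a & v]).
Proof.
move=> uu xu axb; rewrite /search_tree !foldl_cat /= (@leaf_insertC a x b) //.
  exact: search_tree_bst.
by rewrite (perm_mem (search_tree_labels u)).
Qed.

(** * Canopies *)

(** The values of e on the consecutive pairs of s; [behead] discards the value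
    at the dummy initial letter 0. *)
Definition consecutive (e : rel nat) (s : seq nat) : seq bool := behead (pairmap e 0 s).

Lemma canopy_node l r : canopy (Node l r) =
  (if l is Leaf then [::] else rcons (canopy l) false) ++
  (if r is Leaf then [::] else true :: canopy r).
Proof.
apply: (@canopy_of false) => /=.
by case: l => [|l1 l2]; case: r => [|r1 r2]; rewrite ?leavesE //= ?rcons_cat ?cats0 //=
  -cats1 -?catA.
Qed.

(** The leaf between two consecutive labels x and y is a left child exactly when
    x is an ancestor of y; otherwise y is an ancestor of x.  Stating this for any
    relation e that orients the ancestor pairs makes it apply to all
    subtrees with the same e. *)
Lemma canopy_consecutive (e : rel nat) T :
  (forall x y, ancestor T x y -> e x y /\ ~~ e y x) ->
  canopy (unlabel T) = consecutive e (labels T).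
Proof.
elim: T => // l IHl x r IHr eT.
have el y z : ancestor l y z -> e y z /\ ~~ e z y.
  by move=> yz; apply: eT => /=; rewrite yz orbT.
have er y z : ancestor r y z -> e y z /\ ~~ e z y.
  by move=> yz; apply: eT => /=; rewrite yz !orbT.
have xl y : y \in labels l -> e y x = false.
  by move=> yl; apply/negbTE; case: (eT x y); rewrite //= eqxx mem_cat yl.
have xr y : y \in labels r -> e x y.
  by move=> yr; case: (eT x y); rewrite //= eqxx mem_cat yr orbT.
have leafE T (s1 s2 : seq bool) :
    (if unlabel T is Leaf then s1 else s2) = (if labels T is [::] then s1 else s2).
  by case: T => //= l' x' r'; case: (labels l').
have -> : labels (LNode l x r) = labels l ++ x :: labels r by [].
rewrite [unlabel _]/= canopy_node !leafE IHl // IHr // /consecutive pairmap_cat.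
case: (labels l) xl => [|a s] xl; case: (labels r) xr => [|b t] xr /=;
  rewrite ?(xr b) ?mem_head ?cats0 //= ?xl ?mem_last ?cats1 //.
by rewrite -cats1 -catA.
Qed.

(** The i-th letter of the canopy of a search tree tells whether the i-th
    smallest letter of the word stands before the next larger one, and this is
    negated by reversing the word. *)
Lemma twin_insertion_pair w : uniq w -> twin (insertion_pair w).
Proof.
move=> uw; rewrite twinE /=.
have lE : labels (search_tree (rev w)) = labels (search_tree w).
  by apply: labels_search_tree; rewrite ?rev_uniq // perm_rev.
rewrite -!size_labels lE eqxx /=.
rewrite (@canopy_consecutive (fun x y => ~~ (index x w < index y w)) (search_tree _)).
  rewrite (@canopy_consecutive (fun x y => index x w < index y w)).
    rewrite lE /consecutive; case: (labels _) => //= x s.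
    by apply/eqP; elim: s x => //= y s IHs x; rewrite IHs.
  by move=> x y /ancestor_prec; rewrite prec_index // => /andP[+ _]; lia.
by move=> x y /ancestor_prec; rewrite prec_rev prec_index // => /andP[+ _]; lia.
Qed.

(** * Transporting the order along a class *)

(** An instance of the Baxter congruence: a witness x on the left makes the
    exchange invisible in the left tree, a witness y on the right in the right
    tree. *)
Lemma insertion_pair_swap p q x y a b : uniq (p ++ [:: a, b & q]) ->
  x \in p -> a < x < b -> y \in q -> a < y < b ->
  insertion_pair (p ++ [:: a, b & q]) = insertion_pair (p ++ [:: b, a & q]).
Proof.
rewrite cat_uniq /= => /and3P[up _ /and3P[_ _ uq]] xp axb yq ayb.
rewrite /insertion_pair (search_tree_swap _ up xp axb); congr (_, unlabel _).
rewrite !rev_cat !rev_cons -!cats1 -!catA /=.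
by apply/esym/(@search_tree_swap _ _ y); rewrite ?rev_uniq ?mem_rev.
Qed.

(** A termination measure: it strictly decreases when a descent is undone. *)
Fixpoint weight (w : seq nat) : nat :=
  if w is x :: w' then x * size w + weight w' else 0.

Lemma weight_swap p q a b : a < b ->
  weight (p ++ [:: a, b & q]) < weight (p ++ [:: b, a & q]).
Proof.
move=> ab; elim: p => [|x p IHp] /=; first nia.
by rewrite !size_cat /= ltn_add2l.
Qed.

(** The first letter less than b is at most a, and the letter before it is at
    least b. *)
Lemma adjacent_descent a b b0 q : b <= b0 ->
  {in q, forall z, (z <= a) || (b <= z)} ->
  exists q1 b' a' q2,
    [/\ b0 :: rcons q a = q1 ++ [:: b', a' & q2], b <= b' & a' <= a].
Proof.
elim: q b0 => [|z q IHq] b0 bb0 qP; first by exists [::], b0, a, [::].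
have /orP[za|bz] := qP z (mem_head _ _).
  by exists [::], b0, z, (rcons q a).
have [|q1 [b' [a' [q2 [qE bb' aa']]]]] := IHq z bz.
  by move=> t tq; apply: qP; rewrite inE tq orbT.
by exists (b0 :: q1), b', a', q2; rewrite /= -qE.
Qed.

Lemma insertion_pair_search_tree v w : uniq v -> perm_eq v w ->
  insertion_pair v = insertion_pair w ->
  search_tree v = search_tree w /\ search_tree (rev v) = search_tree (rev w).
Proof.
move=> uv pvw [e1 e2]; split; apply: ltree_eq => //.
  exact: labels_search_tree.
by apply: labels_search_tree; rewrite ?rev_uniq // perm_rev perm_sym perm_rev perm_sym.
Qed.

(** Inversion (b, a) of u that w lacks.  When a letter z between them in value
    also stands between them in u, one of (b, z) and (z, a) is again such an
    inversion, and closer in value; so there may be assumed to be no such z.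
    Then u has an adjacent descent b' a' with a' <= a and b <= b'.  The letters x
    and y separating a from b in the search trees of v precede b and follow a in
    v, hence in u since u <= v, and they also separate a' from b'. *)
Lemma exists_swappable_descent u v w a b :
  uniq v -> weak_le u v -> perm_eq v w -> insertion_pair v = insertion_pair w ->
  a < b -> prec u b a -> prec w a b ->
  exists p q a' b' x y, [/\ u = p ++ [:: b', a' & q],
    x \in p, a' < x < b', y \in q & a' < y < b'].
Proof.
move=> uv le_uv pvw svw.
have [tvw tvw'] := insertion_pair_search_tree uv pvw svw.
have uw : uniq w by rewrite -(perm_uniq pvw).
have puv : perm_eq u v by case: le_uv.
have uu : uniq u by rewrite (perm_uniq puv).
have [k] := ubnP (b - a); elim: k a b => // k IHk a b kab ab uba wab.
have [p [q [r uE]]] := precP uba.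
(* a letter z of value between a and b gives a pair closer in value *)
have [/hasP[z zq /andP[az zb]]|nq] := boolP (has (fun z => a < z < b) q).
  have ubz : prec u b z by rewrite uE prec_cat prec_cons eqxx mem_cat zq !orbT.
  have uza : prec u z a.
    by rewrite uE prec_cat prec_cons prec_cat zq mem_head !orbT.
  have [bw zw] : b \in w /\ z \in w.
    by rewrite -!(perm_mem pvw) -!(perm_mem puv); apply: prec_mem.
  have : z != b by rewrite neq_ltn zb.
  move=> /(prec_total uw zw bw)/orP[wzb|wbz].
    by apply: (IHk z b) => //; move: kab az zb; clear; lia.
  by apply: (IHk a z) (prec_trans uw wab wbz) => //; move: kab az zb; clear; lia.
have vba : prec v b a by case: le_uv => _; apply.
have [|x [axb vxa vxb]] := same_tree_separator uw uv (esym tvw) ab.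
  by rewrite wab vba.
(* x comes before a and b in v; reversing gives y after both *)
have [uv' uw'] : uniq (rev v) /\ uniq (rev w) by rewrite !rev_uniq.
have [|y [ayb]] := same_tree_separator uw' uv' (esym tvw') ab.
  by rewrite !prec_rev wab vba orbT.
rewrite !prec_rev => vay vby.
have xp : x \in p.
  have : prec u x b by case/andP: axb => _ xb; apply: weak_le_prec vxb.
  rewrite uE prec_cat prec_cons => /or3P[/prec_mem[]//| |/andP[]//].
  have nxb : x != b by rewrite neq_ltn; case/andP: axb => _ ->.
  rewrite (negPf nxb) /= => /prec_mem[_ bqr].
  by move: uu; rewrite uE cat_uniq /= bqr !andbF.
have yr : y \in r.
  have : prec u a y by case/andP: ayb => ay _; apply: weak_le_prec vay.
  have nya : y != a by rewrite neq_ltn orbC; case/andP: ayb => ->.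
  rewrite uE -cat_cons catA prec_cat prec_cons.
  have aN : a \notin p ++ b :: q.
    by move: uu; rewrite uE -cat_cons catA cat_uniq /= negb_or => /and3P[_ /andP[]].
  case/or3P => [/prec_mem[]|/orP[/andP[]//|/prec_mem[]//]|]; rewrite (negPf aN) //.
have [|q1 [b' [a' [q2 [qE bb' aa']]]]] := @adjacent_descent a b b q (leqnn b).
  by move=> z zq; have /hasPn/(_ _ zq) := nq; clear; lia.
exists (p ++ q1), (q2 ++ r), a', b', x, y; split; rewrite ?mem_cat ?xp ?yr ?orbT //;
  try by move: axb ayb bb' aa'; clear; lia.
have -> : u = p ++ (b :: rcons q a) ++ r by rewrite uE /= cat_rcons.
by rewrite qE -!catA.
Qed.

(** Undo the descents given by [exists_swappable_descent] until every inversion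
    of u is one of w; each step preserves the twin trees and goes down, so it
    stays below v. *)
Lemma weak_le_class u v w : uniq v -> weak_le u v -> perm_eq v w ->
  insertion_pair v = insertion_pair w ->
  exists2 u', insertion_pair u' = insertion_pair u & weak_le u' w.
Proof.
move=> uv + pvw svw.
have [k] := ubnP (weight u); elim: k u => // k IHk u ku le_uv.
have puv : perm_eq u v by case: le_uv.
have [[a [b [ab uba nwba]]]|no] :=
  EM (exists a b, [/\ a < b, prec u b a & ~~ prec w b a]); last first.
  exists u => //; split=> [|a b ab uba]; first exact: perm_trans puv pvw.
  by apply/negPn/negP => nwba; apply: no; exists a, b.
have uw : uniq w by rewrite -(perm_uniq pvw).
have wab : prec w a b.
  have [bu au] := prec_mem uba.
  have := @prec_total w a b uw; rewrite (negPf nwba) orbF -!(perm_mem pvw).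
  by rewrite -!(perm_mem puv); apply=> //; rewrite neq_ltn ab.
have [p [q [a' [b' [x [y [uE xp axb yq ayb]]]]]]] :=
  exists_swappable_descent uv le_uv pvw svw ab uba wab.
have ab' : a' < b' by case/andP: axb; apply: ltn_trans.
have lt_k : weight (p ++ [:: a', b' & q]) < k.
  by apply: leq_trans (weight_swap p q ab') _; rewrite -uE.
have le_pv : weak_le (p ++ [:: a', b' & q]) v.
  by apply: weak_le_trans le_uv; rewrite uE; apply: weak_le_swap.
have [u' su' le_u'] := IHk _ lt_k le_pv.
exists u' => //; rewrite su' uE; apply: insertion_pair_swap xp axb yq ayb.
by rewrite (perm_uniq (swap_perm _ _ _ _)) -uE (perm_uniq puv).
Qed.

(** * Grafts and concatenation *)

Fixpoint lgraft_over (T U : ltree) : ltree :=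
  if U is LNode l x r then LNode (lgraft_over T l) x r else T.

Fixpoint lgraft_under (T U : ltree) : ltree :=
  if T is LNode l x r then LNode l x (lgraft_under r U) else U.

Lemma unlabel_over T U :
  unlabel (lgraft_over T U) = graft_over (unlabel T) (unlabel U).
Proof. by elim: U => //= l -> x r _. Qed.

Lemma unlabel_under T U :
  unlabel (lgraft_under T U) = graft_under (unlabel T) (unlabel U).
Proof. by elim: T => //= l _ x r ->. Qed.

Lemma labels_over T U : labels (lgraft_over T U) = labels T ++ labels U.
Proof. by elim: U => [|l IHl x r _] /=; rewrite ?cats0 // IHl catA. Qed.

Lemma labels_under T U : labels (lgraft_under T U) = labels T ++ labels U.
Proof. by elim: T => //= l _ x r ->; rewrite -catA. Qed.

Section Threshold.

Variable n : nat.
Notation low := (all (leq^~ n)).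
Notation high := (all (ltn n)).

Lemma insert_over a T U : a <= n -> high (labels U) ->
  leaf_insert a (lgraft_over T U) = lgraft_over (leaf_insert a T) U.
Proof.
move=> an; elim: U => //= l IHl x r _; rewrite all_cat => /and3P[hl /= nx _].
by rewrite (leq_ltn_trans an nx) IHl.
Qed.

Lemma insert_under a T U : n < a -> low (labels T) ->
  leaf_insert a (lgraft_under T U) = lgraft_under T (leaf_insert a U).
Proof.
move=> na; elim: T => //= l _ x r IHr; rewrite all_cat => /and3P[_ /= xn hr].
by rewrite ltnNge (leq_trans xn (ltnW na)) /= IHr.
Qed.

Lemma cut_low T : low (labels T) -> cut_le n T = T /\ cut_gt n T = LLeaf.
Proof.
elim: T => //= l _ x r IHr; rewrite all_cat => /and3P[_ /= -> /IHr[]].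
by move=> -> ->.
Qed.

Lemma cut_high T : high (labels T) -> cut_le n T = LLeaf /\ cut_gt n T = T.
Proof.
elim: T => //= l IHl x r _; rewrite all_cat => /and3P[/IHl[] + + /= nx _].
by rewrite leqNgt nx /= => -> ->.
Qed.

Lemma cut_over T U : low (labels T) -> high (labels U) ->
  cut_le n (lgraft_over T U) = T /\ cut_gt n (lgraft_over T U) = U.
Proof.
move=> lT; elim: U => [_|l IHl x r _] /=; first exact: cut_low.
rewrite all_cat => /and3P[/IHl[-> ->] /= nx _].
by rewrite leqNgt nx.
Qed.

Lemma cut_under T U : low (labels T) -> high (labels U) ->
  cut_le n (lgraft_under T U) = T /\ cut_gt n (lgraft_under T U) = U.
Proof.
move=> + hU; elim: T => [_|l _ x r IHr] /=; first exact: cut_high.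
by rewrite all_cat => /and3P[_ /= -> /IHr[-> ->]].
Qed.

Lemma search_tree_cat_under u v : low u -> high v ->
  search_tree (u ++ v) = lgraft_under (search_tree u) (search_tree v).
Proof.
move=> lu; elim/last_ind: v => [_|v a IHv].
  by rewrite cats0 /=; elim: (search_tree u) => //= l _ x r <-.
rewrite all_rcons -rcons_cat !search_tree_rcons => /andP[na /IHv->].
by rewrite insert_under // (perm_all _ (search_tree_labels u)).
Qed.

Lemma search_tree_cat_over u v : low u -> high v ->
  search_tree (v ++ u) = lgraft_over (search_tree u) (search_tree v).
Proof.
move=> + hv; elim/last_ind: u => [_|u a IHu].
  by rewrite cats0 /=; elim: (search_tree v) => //= l <-.
rewrite all_rcons -rcons_cat !search_tree_rcons => /andP[na /IHu->].
by rewrite insert_over // (perm_all _ (search_tree_labels v)).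
Qed.

End Threshold.

Definition pair_over (J0 J1 : tree * tree) : tree * tree :=
  (graft_under J0.1 J1.1, graft_over J0.2 J1.2).

(** Larger letters inserted after the smaller ones end up below the rightmost
    leaf; smaller letters inserted after the larger ones, as in the reversed
    word, end up below the leftmost leaf. *)
Lemma insertion_pair_cat n u v : all (leq^~ n) u -> all (ltn n) v ->
  insertion_pair (u ++ v) = pair_over (insertion_pair u) (insertion_pair v).
Proof.
move=> lu hv; rewrite /insertion_pair /pair_over rev_cat /=.
rewrite (search_tree_cat_under lu hv) unlabel_under.
by rewrite (@search_tree_cat_over n) ?all_rev // unlabel_over.
Qed.

Fixpoint map_labels (f : nat -> nat) (T : ltree) : ltree :=
  if T is LNode l x r then LNode (map_labels f l) (f x) (map_labels f r) else LLeaf.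

Lemma unlabel_map f T : unlabel (map_labels f T) = unlabel T.
Proof. by elim: T => //= l -> x r ->. Qed.

Lemma search_tree_shift n w :
  search_tree [seq x + n | x <- w] = map_labels (addn^~ n) (search_tree w).
Proof.
elim/last_ind: w => // w a IHw; rewrite map_rcons !search_tree_rcons {}IHw.
by elim: (search_tree w) => //= l IHl x r IHr; rewrite ltn_add2r IHl IHr; case: ifP.
Qed.

Lemma insertion_pair_shift n w : insertion_pair [seq x + n | x <- w] = insertion_pair w.
Proof. by rewrite /insertion_pair -map_rev !search_tree_shift !unlabel_map. Qed.

Definition low_part (n : nat) (w : seq nat) : seq nat := [seq x <- w | x <= n].
Definition high_part (n : nat) (w : seq nat) : seq nat :=
  [seq x - n | x <- w & n < x].

Lemma shift_high_part n w :
  [seq x + n | x <- high_part n w] = [seq x <- w | n < x].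
Proof.
rewrite /high_part -map_comp -[RHS]map_id; apply/eq_in_map => x.
by rewrite mem_filter => /andP[nx _] /=; rewrite subnK // ltnW.
Qed.

(** T is the graft of the two trees T0 and T1 suitably labeled, and cutting this
    graft at n gives back its two parts. *)
Lemma cut_graft n m T T0 T1 (b : bool) :
  labels T = iota 1 (n + m) -> nodes T0 = n ->
  unlabel T = (if b then graft_over else graft_under) T0 T1 ->
  unlabel (cut_le n T) = T0 /\ unlabel (cut_gt n T) = T1.
Proof.
move=> lT nT0 uT.
have nT1 : nodes T1 = m.
  have := size_labels T; rewrite lT size_iota uT.
  by case: (b); rewrite ?nodes_over ?nodes_under nT0 => /addnI.
have [|X0 uX0 lX0] := @ltree_of T0 (iota 1 n); first by rewrite size_iota.
have [|X1 uX1 lX1] := @ltree_of T1 (iota (1 + n) m); first by rewrite size_iota.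
have l0 : all (leq^~ n) (labels X0).
  by rewrite lX0; apply/allP => x; rewrite mem_iota /=; lia.
have l1 : all (ltn n) (labels X1).
  by rewrite lX1; apply/allP => x; rewrite mem_iota /=; lia.
have -> : T = (if b then lgraft_over X0 X1 else lgraft_under X0 X1).
  apply: ltree_eq; rewrite ?uT ?lT; case: (b).
  - by rewrite unlabel_over uX0 uX1.
  - by rewrite unlabel_under uX0 uX1.
  - by rewrite labels_over lX0 lX1 -iotaD.
  - by rewrite labels_under lX0 lX1 -iotaD.
by case: (b); [have [-> ->] := cut_over l0 l1 | have [-> ->] := cut_under l0 l1].
Qed.

Lemma insertion_pair_over_parts n m J0 J1 u : perm_eq u (iota 1 (n + m)) ->
  nodes J0.1 = n -> nodes J0.2 = n -> insertion_pair u = pair_over J0 J1 ->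
  insertion_pair (low_part n u) = J0 /\ insertion_pair (high_part n u) = J1.
Proof.
move=> pu n1 n2 [s1 s2].
have pu' : perm_eq (rev u) (iota 1 (n + m)) by rewrite perm_rev.
have [l1 h1] := cut_graft (b := false) (labels_search_tree_iota pu) n1 s1.
have [l2 h2] := cut_graft (b := true) (labels_search_tree_iota pu') n2 s2.
rewrite -(insertion_pair_shift n (high_part n u)) shift_high_part.
rewrite /insertion_pair /low_part -!filter_rev.
rewrite -!cut_le_search_tree -!cut_gt_search_tree l1 l2 h1 h2.
by rewrite -!surjective_pairing.
Qed.

(** * Permutations above a class *)

Definition above_class (J : tree * tree) (w : seq nat) : Prop :=
  exists2 u, insertion_pair u = J & weak_le u w.

Lemma above_class_over n m J0 J1 w : perm_eq w (iota 1 (n + m)) ->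
  nodes J0.1 = n -> nodes J0.2 = n ->
  above_class (pair_over J0 J1) w <->
  above_class J0 (low_part n w) /\ above_class J1 (high_part n w).
Proof.
move=> pw n1 n2; split=> [[u su le_uw]|[[u0 su0 le_u0] [u1 su1 le_u1]]].
  have pu : perm_eq u (iota 1 (n + m)) by case: le_uw => puw _; apply: perm_trans pw.
  have [s0 s1] := insertion_pair_over_parts pu n1 n2 su.
  split; [exists (low_part n u) => // | exists (high_part n u) => //].
    exact: weak_le_filter.
  by apply: (@weak_le_shift n); rewrite !shift_high_part; apply: weak_le_filter.
have [p0 i0] := le_u0; have [p1 i1] := le_u1.
set v1 := [seq x + n | x <- u1].
have p1' : perm_eq v1 [seq x <- w | n < x].
  by rewrite -shift_high_part; apply: perm_map.
have l0 : all (leq^~ n) u0 by rewrite (perm_all _ p0) filter_all.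
have h1 : all (ltn n) v1 by rewrite (perm_all _ p1') filter_all.
exists (u0 ++ v1).
  by rewrite (insertion_pair_cat l0 h1) su0 insertion_pair_shift su1.
split.
  have gtE : filter (ltn n) w = filter (predC (leq^~ n)) w.
    by apply: eq_filter => x /=; rewrite ltnNge.
  rewrite -(permPr (permEl (perm_filterC (leq^~ n) w))) -gtE.
  exact: perm_cat.
move=> a b ab; rewrite prec_cat => /or3P[|v1ba|/andP[bu0 av1]].
- by move=> /(i0 _ _ ab); rewrite prec_filter => /and3P[].
- have [bv av] := prec_mem v1ba.
  have [/= na nb] := (allP h1 _ av, allP h1 _ bv).
  move: v1ba; rewrite -(subnK (ltnW na)) -(subnK (ltnW nb)) prec_shift.
  have ab' : a - n < b - n by rewrite ltn_sub2r // (leq_trans na (ltnW ab)).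
  move=> /(i1 _ _ ab'); rewrite -(prec_shift n) shift_high_part prec_filter.
  by case/and3P.
- by have /= := allP l0 _ bu0; have /= := allP h1 _ av1; lia.
Qed.

(** * Shuffles *)

Lemma filter_nilK (T : eqType) (p : pred T) w :
  [seq x <- w | p x] = [::] -> [seq x <- w | predC p x] = w.
Proof.
by move/eqP; rewrite -[_ == _]negbK -has_filter -all_predC => /all_filterP.
Qed.

(** When p tells the letters of u from those of v, a shuffle of u and v is
    determined by, and determines, its two restrictions. *)
Lemma mem_shuffle (T : eqType) (p : pred T) u v w : all p u -> all (predC p) v ->
  (w \in shuffle u v) =
  ([seq x <- w | p x] == u) && ([seq x <- w | predC p x] == v).
Proof.
have mem_cons (c b : T) (z : seq T) s :
    (c :: z \in [seq b :: y | y <- s]) = (c == b) && (z \in s).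
  have [<-|ncb] := eqVneq c b; first by rewrite mem_map // => ? ? [].
  by apply/negbTE/mapP => -[y _ [cb]]; rewrite cb eqxx in ncb.
elim: u v w => [|a u IHu] v w /=.
  move=> _ pv; rewrite inE; apply/eqP/andP => [->|[/eqP wu /eqP <-]].
    rewrite (all_filterP pv) eqxx -[_ == _]negbK -has_filter -all_predC //.
  by rewrite filter_nilK.
case/andP=> pa pu; elim: v w => [|b v IHv] w /=.
  move=> _; rewrite inE; apply/eqP/andP => [->|[/eqP <- /eqP wv]].
    rewrite /= pa (all_filterP pu) /= eqxx -[_ == _]negbK -has_filter -all_predC.
    by split=> //; apply: sub_all pu => x /= ->.
  by rewrite -[LHS](filter_nilK wv); apply: eq_filter => x; rewrite /= negbK.
case/andP=> pb pv; rewrite mem_cat.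
case: w => [|c w].
  by rewrite /=; apply/negbTE; rewrite negb_or; apply/andP; split; apply/mapP => -[].
rewrite !mem_cons IHu //= ?pb // IHv //.
have [pc|pc] := boolP (p c); rewrite /= !eqseq_cons.
  have -> : (c == b) = false by apply: contraTF pb => /eqP <-; rewrite negbK.
  by rewrite orbF andbA.
have -> : (c == a) = false by apply: contraNF pc => /eqP ->.
by rewrite /= andbCA.
Qed.

Lemma uniq_shuffle (T : eqType) (p : pred T) u v :
  all p u -> all (predC p) v -> uniq (shuffle u v).
Proof.
elim: u v => [|a u IHu] //= v /andP[pa pu]; elim: v => [|b v IHv] //= /andP[pb pv].
have consI (c : T) : injective (cons c) by move=> ? ? [].
rewrite cat_uniq !map_inj_uniq // IHu //= ?pb // IHv // andbT.
apply/hasP => -[w /mapP[y _ ->] /mapP[z _ [ba _]]].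
by rewrite ba pa in pb.
Qed.

Lemma permut_iota n (s : permut) : s \in permuts n -> perm_eq s (iota 1 n).
Proof. by rewrite mem_permuts => /eqP <-; apply: wordP. Qed.

Lemma mem_permut (s : permut) x : (x \in word s) = (0 < x <= size s).
Proof. by rewrite (perm_mem (wordP s)) mem_iota add1n ltnS. Qed.

Lemma is_permut_mem k w : uniq w -> (forall x, (x \in w) = (0 < x <= k)) ->
  is_permut w.
Proof.
move=> uw wE; have pw : perm_eq w (iota 1 k).
  by apply: uniq_perm; rewrite ?iota_uniq // => x; rewrite wE mem_iota add1n ltnS.
by rewrite /is_permut (perm_size pw) size_iota.
Qed.

Lemma mem_high_part n w x : (x \in high_part n w) = (0 < x) && (x + n \in w).
Proof.
rewrite -(mem_map (@addIn n)) shift_high_part mem_filter.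
by congr (_ && _); lia.
Qed.

Lemma low_part_permut n (s : permut) : is_permut (low_part n s).
Proof.
apply: (@is_permut_mem (minn n (size s))); first exact/filter_uniq/permut_uniq.
by move=> x; rewrite mem_filter mem_permut; lia.
Qed.

Lemma high_part_permut n (s : permut) : is_permut (high_part n s).
Proof.
apply: (@is_permut_mem (size s - n)).
  by rewrite -(map_inj_uniq (@addIn n)) shift_high_part filter_uniq ?permut_uniq.
by move=> x; rewrite mem_high_part mem_permut; lia.
Qed.

Definition low_permut n (s : permut) : permut := Permut (low_part_permut n s).
Definition high_permut n (s : permut) : permut := Permut (high_part_permut n s).

Lemma size_parts n w : size (low_part n w) + size (high_part n w) = size w.
Proof.
rewrite size_map !size_filter -(count_predC (leq^~ n) w); congr (_ + _).
by apply: eq_count => x; rewrite /= ltnNge.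
Qed.

Lemma size_low_permut n m (p : permut) : p \in permuts (n + m) ->
  size (low_permut n p) = n.
Proof.
move=> /permut_iota/(perm_filter (leq^~ n))/perm_size /= ->.
rewrite iotaD filter_cat size_cat !size_filter.
have /eqP -> : count (leq^~ n) (iota 1 n) == size (iota 1 n).
  by rewrite -all_count; apply/allP => x; rewrite mem_iota; lia.
rewrite size_iota; apply/eqP; rewrite -[X in _ == X]addn0 eqn_add2l.
rewrite -leqn0 leqNgt -has_count.
by apply/hasP => -[x]; rewrite mem_iota; lia.
Qed.

Lemma mem_shifted_shuffle (s t p : permut) : (p \in shifted_shuffle s t) =
  (low_permut (size s) p == s) && (high_permut (size s) p == t).
Proof.
set n := size s.
rewrite -(mem_map val_inj) map_shifted_shuffle (@mem_shuffle _ (leq^~ n)).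
- rewrite -!val_eqE /=; congr (_ && _).
  rewrite -[X in _ = X](inj_eq (inj_map (@addIn n))) shift_high_part.
  by congr (_ == _); apply: eq_in_filter => x _; rewrite /= ltnNge.
- by apply/allP => x; rewrite mem_permut => /andP[].
- by apply/allP => _ /mapP[x + ->] /=; rewrite mem_permut -/n; lia.
Qed.

Lemma perm_shifted_shuffle (s t : permut) : perm_eq (shifted_shuffle s t)
  [seq p <- permuts (size s + size t) |
     (low_permut (size s) p == s) && (high_permut (size s) p == t)].
Proof.
apply: uniq_perm; last 1 first.
- move=> p; rewrite mem_shifted_shuffle mem_filter mem_permuts.
  case: eqP => //= /(congr1 word) /= lE; case: eqP => //= /(congr1 word) /= hE.
  by rewrite -(size_parts (size s) p) lE hE eqxx.
- apply: (@map_uniq _ _ word); rewrite map_shifted_shuffle.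
  apply: (@uniq_shuffle _ (leq^~ (size s))).
    by apply/allP => x; rewrite mem_permut => /andP[].
  by apply/allP => _ /mapP[x + ->] /=; rewrite mem_permut; lia.
- exact/filter_uniq/uniq_permuts.
Qed.

Local Open Scope ring_scope.

(** * Sums over sets of permutations *)

Lemma sum_fibers (V : nmodType) (I J : eqType) (r : seq I) (q : seq J)
    (f : I -> J) (P : pred I) (Q : pred J) (F : I -> V) :
  uniq q -> {in r, forall i, f i \in q} ->
  \sum_(j <- q | Q j) \sum_(i <- r | P i && (f i == j)) F i =
  \sum_(i <- r | P i && Q (f i)) F i.
Proof.
move=> uq fq.
under eq_bigr do rewrite big_mkcondr.
rewrite exchange_big /= [RHS]big_mkcondr big_seq_cond [RHS]big_seq_cond.
apply: eq_bigr => i /andP[ir _].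
rewrite big_mkcond (bigD1_seq (f i)) ?fq //= eqxx big1 ?addr0 // => j.
by rewrite eq_sym => /negPf->; rewrite if_same.
Qed.

Section Sums.

Variable K : fieldType.

Lemma mcoeff_sum_fqF (r : seq permut) t : uniq r ->
  (\sum_(s <- r) fqF K s)@_t = (t \in r)%:R.
Proof.
move=> ur; rewrite raddf_sum /=; under eq_bigr do rewrite mcoeffU.
have [tr|tr] := boolP (t \in r).
  rewrite (bigD1_seq t) //= eqxx big1 ?addr0 // => s /negPf.
  by rewrite eq_sym => /negPf; rewrite eq_sym => /negPf->.
rewrite big1_seq // => s /andP[_ sr]; case: eqP => // st.
by rewrite st (negPf tr) in sr.
Qed.

Lemma perm_msupp_sum_fqF (r : seq permut) : uniq r ->
  perm_eq (msupp (\sum_(s <- r) fqF K s)) r.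
Proof.
move=> ur; apply: uniq_perm => // t.
rewrite -mcoeff_neq0 mcoeff_sum_fqF //.
by case: (t \in r); rewrite ?oner_eq0 ?eqxx.
Qed.

Lemma fqmul_sum_fqF (q r : seq permut) : uniq q -> uniq r ->
  fqmul (\sum_(s <- q) fqF K s) (\sum_(t <- r) fqF K t) =
  \sum_(s <- q) \sum_(t <- r) \sum_(p <- shifted_shuffle s t) fqF K p.
Proof.
move=> uq ur; rewrite /fqmul (perm_big _ (perm_msupp_sum_fqF uq)) /=.
rewrite big_seq [RHS]big_seq; apply: eq_bigr => s sq.
rewrite (perm_big _ (perm_msupp_sum_fqF ur)) /=.
rewrite big_seq [RHS]big_seq; apply: eq_bigr => t tr.
by rewrite !mcoeff_sum_fqF // sq tr mulr1 scale1r.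
Qed.

(** The product of the indicator sums of A and B is the indicator sum of the
    permutations whose two parts lie in A and B. *)
Lemma fqmul_word_sets (A B C : seq nat -> Prop) n m :
  (forall w, perm_eq w (iota 1 (n + m)) ->
    C w <-> A (low_part n w) /\ B (high_part n w)) ->
  fqmul (\sum_(s <- permuts n | `[<A s>]) fqF K s)
        (\sum_(t <- permuts m | `[<B t>]) fqF K t) =
  \sum_(p <- permuts (n + m) | `[<C p>]) fqF K p.
Proof.
move=> CP; rewrite -[X in fqmul X _]big_filter -[X in fqmul _ X]big_filter.
rewrite fqmul_sum_fqF ?filter_uniq ?uniq_permuts // big_filter.
have lowP : {in permuts (n + m), forall p, low_permut n p \in permuts n}.
  by move=> p /size_low_permut; rewrite mem_permuts => ->.
have highP : {in permuts (n + m), forall p, high_permut n p \in permuts m}.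
  move=> p pnm; have lE := size_low_permut pnm.
  move: pnm; rewrite !mem_permuts -(size_parts n p) [size (low_part n p)]lE.
  by rewrite eqn_add2l.
transitivity (\sum_(s <- permuts n | `[<A s>])
    \sum_(p <- permuts (n + m) | `[<B (high_permut n p)>] && (low_permut n p == s))
      fqF K p).
  rewrite big_seq_cond [RHS]big_seq_cond; apply: eq_bigr => s /andP[sn _].
  rewrite big_filter.
  under [RHS]eq_bigl do rewrite andbC.
  rewrite -(sum_fibers (fun p => low_permut n p == s) (fun t : permut => `[<B t>]) _
    (uniq_permuts m) highP).
  rewrite big_seq_cond [RHS]big_seq_cond; apply: eq_bigr => t /andP[tm _].
  rewrite (perm_big _ (perm_shifted_shuffle s t)) big_filter.
  move: sn tm; rewrite !mem_permuts => /eqP sn /eqP tm.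
  by rewrite sn tm.
rewrite (sum_fibers (fun p : permut => `[<B (high_permut n p)>])
  (fun s : permut => `[<A s>]) _
  (uniq_permuts n) lowP).
rewrite big_seq_cond [RHS]big_seq_cond; apply: eq_bigl => p.
have [pnm|//] := boolP (p \in permuts (n + m)) => /=.
rewrite -asbool_and; apply: asbool_equiv_eq.
by have := CP _ (permut_iota pnm); rewrite /=; tauto.
Qed.

Lemma twin_P_symbol (s : permut) : twin (P_symbol s).
Proof. by rewrite P_symbolE; apply/twin_insertion_pair/permut_uniq. Qed.

Definition tbt_of (s : permut) : TBT := Tbt (twin_P_symbol s).

Lemma tbt_size_of s : tbt_size (tbt_of s) = size s.
Proof.
by rewrite /tbt_size /= P_symbolE /= -size_labels (perm_size (search_tree_labels s)).
Qed.

(** Each permutation s contributes to the single J equal to P(s). *)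
Lemma sum_baxterP (D : TBT -> Prop) n :
  \sum_(J <- tbts n | `[<D J>]) baxterP K J =
  \sum_(s <- permuts n | `[<D (tbt_of s)>]) fqF K s.
Proof.
have ofP : {in permuts n, forall s, tbt_of s \in tbts n}.
  by move=> s; rewrite mem_permuts mem_tbts tbt_size_of.
rewrite -(sum_fibers predT (fun J => `[<D J>]) _ (uniq_tbts n) ofP) /=.
rewrite big_seq_cond [RHS]big_seq_cond; apply: eq_bigr => J /andP[].
by rewrite mem_tbts => /eqP <- _.
Qed.

End Sums.

Lemma P_symbol_size (s t : permut) : P_symbol s = P_symbol t -> size s = size t.
Proof.
by rewrite -!tbt_size_of /tbt_size /= => ->.
Qed.

Lemma perm_eq_P_symbol (s t : permut) : P_symbol s = P_symbol t -> perm_eq s t.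
Proof.
move/P_symbol_size=> st; rewrite (permPl (wordP s)) st perm_sym; exact: wordP.
Qed.

Lemma weak_le_permut (s : permut) w : weak_le w s \/ weak_le s w -> is_permut w.
Proof.
have pE : perm_eq w s -> is_permut w.
  by move=> ws; rewrite /is_permut (permPl ws) (perm_size ws); apply: wordP.
by case=> -[]; [|rewrite perm_sym] => /pE.
Qed.

(** * The elementary and homogeneous families *)

(** The representative of P(s) that appears in the definition of the order can be
    replaced by s itself, thanks to [weak_le_class]. *)
Lemma tbt_leP (J : TBT) (s : permut) : tbt_le J (tbt_of s) <-> above_class J s.
Proof.
split=> [[s0 [s1 [s0J s1s /perm_leP le01]]]|[u uJ le_us]].
  have ps := perm_eq_P_symbol s1s.
  rewrite /= !P_symbolE in s1s; rewrite P_symbolE in s0J.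
  have [u su le_us] := weak_le_class (permut_uniq s1) le01 ps s1s.
  by exists u; rewrite // su.
have uP : is_permut u by apply: (@weak_le_permut s); left.
by exists (Permut uP), s; split; [rewrite P_symbolE| |apply/perm_leP].
Qed.

(** The mirror image of [tbt_leP] under the reversal of words. *)
Lemma tbt_geP (J : TBT) (s : permut) :
  tbt_le (tbt_of s) J <-> above_class (swap_pair J) (rev s).
Proof.
split=> [[s0 [s1 [s0s s1J /perm_leP le01]]]|[u uJ le_us]].
  have ps := perm_eq_P_symbol s0s.
  rewrite /= !P_symbolE in s0s; rewrite P_symbolE in s1J.
  have le10 := weak_le_rev (permut_uniq s1) le01.
  have ur : uniq (rev s0) by rewrite rev_uniq permut_uniq.
  have pr : perm_eq (rev s0) (rev s).
    by rewrite perm_rev perm_sym perm_rev perm_sym.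
  have sr : insertion_pair (rev s0) = insertion_pair (rev s) by rewrite !insertion_pair_rev s0s.
  have [u su le_us] := weak_le_class ur le10 pr sr.
  by exists u; rewrite // su insertion_pair_rev s1J.
have := weak_le_rev _ le_us; rewrite rev_uniq revK permut_uniq => /(_ isT) le_su.
have uP : is_permut (rev u) by apply: (@weak_le_permut s); right.
exists s, (Permut uP); split=> //; last exact/perm_leP.
by rewrite P_symbolE insertion_pair_rev uJ /swap_pair /= -surjective_pairing.
Qed.

Section Bases.

Variable K : fieldType.

Lemma baxterE_above (J : TBT) : baxterE K J =
  \sum_(s <- permuts (tbt_size J) | `[<above_class J s>]) fqF K s.
Proof.
rewrite /baxterE sum_baxterP; apply: eq_bigl => s.
by apply: asbool_equiv_eq; apply: tbt_leP.
Qed.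

Lemma baxterH_above (J : TBT) : baxterH K J =
  \sum_(s <- permuts (tbt_size J) | `[<above_class (swap_pair J) (rev s)>]) fqF K s.
Proof.
rewrite /baxterH (sum_baxterP K (fun J' => tbt_le J' J)); apply: eq_bigl => s.
by apply: asbool_equiv_eq; apply: tbt_geP.
Qed.

End Bases.

Theorem proposition6p4 (K : fieldType) (charK : [pchar K] =i pred0)
    (J0 J1 : TBT) :
  fqmul (baxterE K J0) (baxterE K J1) = baxterE K (tbt_over J0 J1) /\
  fqmul (baxterH K J0) (baxterH K J1) = baxterH K (tbt_under J0 J1).
Proof.
have /andP[/eqP tw0 _] := trees_ofP J0.
split.
  rewrite !baxterE_above {3}/tbt_size /= nodes_under.
  apply: (@fqmul_word_sets K (above_class J0) (above_class J1)) => w pw.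
  by apply: (@above_class_over _ (tbt_size J1)).
rewrite !baxterH_above {3}/tbt_size /= nodes_over.
apply: (@fqmul_word_sets K (fun w => above_class (swap_pair J0) (rev w))
  (fun w => above_class (swap_pair J1) (rev w))
  (fun w => above_class (swap_pair (tbt_under J0 J1)) (rev w)))
  => w pw.
rewrite /low_part /high_part -map_rev -!filter_rev.
by apply: (@above_class_over _ (tbt_size J1) (swap_pair J0) (swap_pair J1)); rewrite ?perm_rev.
Qed.
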